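(* There exist absolute constants $C,c>0$ such that the following holds. Let $N\ge 1$ and let $\mathcal{T}$ be the dyadic tree of depth $N$ equipped with the standard graph metric. Then, for $N\ge 2$, $$\operatorname{LCJ}(\mathcal{T})\le C(\log N)^{-\frac12}.$$ However, if $\mathcal{L}$ denotes the set of leaves of $\mathcal{T}$ with the metric induced from $\mathcal{T}$, then, for every $N\ge1$, $$\operatorname{LCJ}(\mathcal{L})\ge c.$$
   Context: The dyadic tree of depth $N$ is the rooted binary tree in which every vertex at distance less than $N$ from the root has exactly two children and the vertices at distance $N$ from the root have none; the latter $2^N$ vertices are its leaves. It is regarded as a metric space: the set of vertices with the shortest-path graph metric (each edge having length $1$). Let $a<b$ be real numbers and let $\mathcal{X}=(\mathcal{X},\rho)$ be a metric space. For a map $\gamma\colon[a,b]\to\mathcal{X}$ (no continuity assumed) set $$\operatorname{V}_\gamma=\sup\sum_{i=1}^m\rho(\gamma(t_{i-1}),\gamma(t_i)),$$ the supremum being over all finite tuples $a=t_0<t_1<\dots<t_m=b$. Write $\gamma\in\operatorname{BV}([a,b],\mathcal{X})$ if $\operatorname{V}_\gamma<\infty$. For $f\colon\mathcal{X}\to\mathbb{R}$ let $L_f=\sup_{x_1\neq x_2}|f(x_1)-f(x_2)|/\rho(x_1,x_2)$ be its global Lipschitz constant, and set $$\operatorname{LV}_\gamma=\sup\{\operatorname{V}_{f\circ\gamma} \mid f\colon\mathcal{X}\to\mathbb{R},\ L_f\le 1\}.$$ Define $$\operatorname{LCJ}(\mathcal{X})=\inf\left\{\frac{\operatorname{LV}_\gamma}{\operatorname{V}_\gamma}\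 \Big|\ \gamma\in\operatorname{BV}([a,b],\mathcal{X})\right\},$$ the quotient being considered only for $\gamma$ with $\operatorname{V}_\gamma>0$. *)

(* Defs.v *)
From HB Require Import structures.
From mathcomp Require Import all_boot all_order all_algebra.
From mathcomp Require Import all_classical all_reals all_analysis.

Set Implicit Arguments.
Unset Strict Implicit.
Unset Printing Implicit Defensive.

Import Order.TTheory GRing.Theory Num.Theory.
Import numFieldNormedType.Exports.

Local Open Scope classical_set_scope.
Local Open Scope ring_scope.

Section LipschitzVariation.
Context {R : realType}.
Implicit Types a b : R.

(* A map [a, b] -> X is represented by a total function R -> X: only its values
   on [a, b] are ever used, since every point of a :: s lies in [a, b] when
   itv_partition a b s holds. *)
Definition curve_variation (X : metricType R) a b (gamma : R -> X) : \bar R :=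
  ereal_sup [set (\sum_(0 <= i < size s)
                   mdist (gamma (nth b (a :: s) i))
                         (gamma (nth b (a :: s) i.+1)))%:E
            | s in itv_partition a b].

(* Extended-real valued; it is -oo, rather than 0, when X has at most one
   point. *)
Definition lipschitz_constant (X : metricType R) (f : X -> R) : \bar R :=
  ereal_sup [set (`|f x.1 - f x.2| / mdist x.1 x.2)%:E
            | x in [set x : X * X | x.1 != x.2]].

(* R^o is R with its usual distance as a metricType. *)
Definition lipschitz_variation (X : metricType R) a b (gamma : R -> X) :
    \bar R :=
  ereal_sup [set curve_variation (X := R^o) a b (f \o gamma)
            | f in [set f : X -> R | (lipschitz_constant f <= 1)%E]].

Definition LCJ a b (X : metricType R) : \bar R :=
  ereal_inf [set (lipschitz_variation a b gamma / curve_variation a b gamma)%E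
            | gamma in [set gamma : R -> X |
                (0 < curve_variation a b gamma < +oo)%E]].

End LipschitzVariation.

(* A vertex is the word of left/right choices leading to it from the root. *)
Section DyadicTree.
Context (N : nat).
Implicit Types (x y z : N.-bseq bool) (m n : nat).

Definition tree_root : N.-bseq bool := [bseq].

Definition tree_child x y : bool := [exists b : bool, y == rcons x b :> seq _].

Definition tree_adj : rel (N.-bseq bool) :=
  [rel x y | tree_child x y || tree_child y x].

Definition tree_walk x y n : bool :=
  [exists p : n.-tuple (N.-bseq bool), path tree_adj x p && (last x p == y)].

Lemma tree_walkP x y n :
  reflect (exists p, [/\ path tree_adj x p, last x p = y & size p = n])
          (tree_walk x y n).
Proof.
apply: (iffP existsP) => [[p /andP[xp /eqP py]]|[p [xp py /eqP pn]]].
  by exists p; rewrite size_tuple.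
by exists (Tuple pn); rewrite /= xp py eqxx.
Qed.

Lemma tree_adj_sym : symmetric tree_adj.
Proof. by move=> x y; rewrite /tree_adj /= orbC. Qed.

Lemma tree_walk0 x y : tree_walk x y 0 = (x == y).
Proof.
apply/tree_walkP/eqP => [[p [_ <- /size0nil ->]]//|->].
by exists [::].
Qed.

Lemma tree_walk_sym x y n : tree_walk x y n -> tree_walk y x n.
Proof.
case/tree_walkP => p [xp <- <-]; apply/tree_walkP.
exists (rev (belast x p)); split; last by rewrite size_rev size_belast.
- rewrite rev_path; apply: sub_path xp => u v /=.
  by rewrite -/(tree_adj v u) tree_adj_sym.
- by case: p {xp} => //= z p; rewrite rev_cons last_rcons.
Qed.

Lemma tree_walk_trans y x z m n :
  tree_walk x y m -> tree_walk y z n -> tree_walk x z (m + n).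
Proof.
case/tree_walkP => p [xp <- <-] /tree_walkP[q [yq <- <-]].
by apply/tree_walkP; exists (p ++ q); rewrite cat_path xp yq last_cat size_cat.
Qed.

Lemma tree_walk_root x : tree_walk tree_root x (size x).
Proof.
case: x => s sN /=; elim/last_ind: s sN => [|s b IHs] sN.
  by rewrite tree_walk0; apply/eqP/val_inj.
have sN' : (size s <= N)%N by rewrite ltnW// -(size_rcons s b).
rewrite size_rcons -addn1; apply: (tree_walk_trans (IHs sN')).
apply/tree_walkP; exists [:: Bseq sN]; split=> //=.
by rewrite andbT; apply/orP; left; apply/existsP; exists b.
Qed.

Lemma tree_connected x y : exists n, tree_walk x y n.
Proof.
exists (size x + size y)%N.
exact: tree_walk_trans (tree_walk_sym (tree_walk_root x)) (tree_walk_root y).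
Qed.

Definition tree_dist x y : nat := ex_minn (tree_connected x y).

Lemma tree_dist_walk x y : tree_walk x y (tree_dist x y).
Proof. by rewrite /tree_dist; case: ex_minnP. Qed.

Lemma tree_dist_min x y n : tree_walk x y n -> (tree_dist x y <= n)%N.
Proof. by rewrite /tree_dist; case: ex_minnP => m _; apply. Qed.

Lemma tree_distxx x : tree_dist x x = 0%N.
Proof. by apply/eqP; rewrite -leqn0 tree_dist_min// tree_walk0. Qed.

Lemma tree_dist_eq0 x y : tree_dist x y = 0%N -> x = y.
Proof. by move=> d0; have := tree_dist_walk x y; rewrite d0 tree_walk0 => /eqP. Qed.

Lemma tree_dist_sym x y : tree_dist x y = tree_dist y x.
Proof.
by apply/eqP; rewrite eqn_leq !tree_dist_min//;
  apply/tree_walk_sym/tree_dist_walk.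
Qed.

Lemma tree_dist_triangle y x z :
  (tree_dist x z <= tree_dist x y + tree_dist y z)%N.
Proof. by apply/tree_dist_min/tree_walk_trans; exact: tree_dist_walk. Qed.

Lemma tree_dist_root x : tree_dist tree_root x = size x.
Proof.
apply/eqP; rewrite eqn_leq tree_dist_min ?tree_walk_root//=.
have /tree_walkP[p [rp <- <-]] := tree_dist_walk tree_root x.
rewrite -[leqRHS]add0n -[X in (_ <= X + _)%N]/(size tree_root).
elim: p tree_root rp => [|u p IHp] r /=; first by rewrite addn0.
case/andP => ru up; apply: leq_trans (IHp _ up) _.
rewrite addnS -addSn leq_add2r.
case/orP: ru => /existsP[b /eqP ->]; rewrite size_rcons//.
by rewrite ltnW.
Qed.

End DyadicTree.

(* The real field is a parameter because metricType is relative to it. *)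
Definition dyadic_tree (R : realType) (N : nat) : Type := N.-bseq bool.

Section DyadicTreeMetric.
Context (R : realType) (N : nat).

HB.instance Definition _ := Choice.on (dyadic_tree R N).

Let dist (x y : dyadic_tree R N) : R := (tree_dist x y)%:R.

Let distxx x : dist x x = 0.
Proof. by rewrite /dist tree_distxx. Qed.

Let dist_positivity x y : dist x y = 0 -> x = y.
Proof. by move/eqP; rewrite pnatr_eq0 => /eqP; exact: tree_dist_eq0. Qed.

Let dist_sym x y : dist x y = dist y x.
Proof. by rewrite /dist tree_dist_sym. Qed.

Let dist_triangle y x z : dist x z <= dist x y + dist y z.
Proof. by rewrite /dist -natrD ler_nat tree_dist_triangle. Qed.

HB.instance Definition _ := isMetric.Build R (dyadic_tree R N)
  distxx dist_positivity dist_sym dist_triangle.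

End DyadicTreeMetric.

Definition tree_leaves (R : realType) (N : nat) : Type :=
  {x : dyadic_tree R N | tree_dist (tree_root N) x == N}.

Section TreeLeavesMetric.
Context (R : realType) (N : nat).

HB.instance Definition _ := Choice.on (tree_leaves R N).

Let dist (x y : tree_leaves R N) : R := mdist (sval x) (sval y).

Let distxx x : dist x x = 0.
Proof. exact: mdistxx. Qed.

Let dist_positivity x y : dist x y = 0 -> x = y.
Proof. by move=> /mdist_positivity /val_inj. Qed.

Let dist_sym x y : dist x y = dist y x.
Proof. exact: metric_sym. Qed.

Let dist_triangle y x z : dist x z <= dist x y + dist y z.
Proof. exact: metric_triangle. Qed.

HB.instance Definition _ := isMetric.Build R (tree_leaves R N)
  distxx dist_positivity dist_sym dist_triangle.

End TreeLeavesMetric.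

(* Main.v *)
Require Import Defs.
From mathcomp Require Import all_boot all_order all_algebra.
From mathcomp Require Import all_classical all_reals all_analysis.
From mathcomp Require Import ring lra zify.

Import Order.TTheory GRing.Theory Num.Theory.

Local Open Scope ring_scope.

(* A curve may run back and forth along any finite list of pairs so often that
   the jumps between pairs become negligible; hence LCJ is the infimum, over
   finite families of pairs, of the largest value of
   sum |f x - f y| / sum d(x, y) for 1-Lipschitz f.

   Leaves: attach an independent random bit to every vertex and let f x be the
   sum over j of 2^j times the bit of the ancestor of x at height 2^j - 1. Since
   the heights are lacunary, f is 1-Lipschitz on the leaves and
   E |f x - f y| >= d(x, y) / 8.

   Tree: by the Markov convexity of the real line, a 1-Lipschitz function along
   a random descending path cannot spread over forks at many scales: the
   normalized energies E |f z - f w|^2 / 4^k of the two tips z, w of a random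
   fork of size 2^k have a sum over all k < K = log_2 N that is bounded
   independently of K. By Cauchy-Schwarz the forks of all scales together give a
   ratio O(K^(-1/2)). *)

(** * Reduction of [LCJ] to finite families of pairs *)

Section Variation.
Context {R : realType}.
Implicit Types (a b : R) (X : metricType R).

Lemma mdist_regular (x y : R^o) : mdist x y = `|x - y|.
Proof. by rewrite distrC. Qed.

Lemma lipschitz1P {X} (f : X -> R) :
  (lipschitz_constant f <= 1)%E <-> forall x y, `|f x - f y| <= mdist x y.
Proof.
split=> [fle1 x y|fle].
  have [->|xy] := eqVneq x y; first by rewrite subrr normr0 mdist_ge0.
  have d0 : 0 < mdist x y by rewrite mdist_gt0.
  rewrite -[leRHS]mul1r -ler_pdivrMr// -lee_fin.
  apply: le_trans fle1; apply: ereal_sup_ubound; by exists (x, y).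
apply: ge_ereal_sup => _ [[x y] /= xy <-].
by rewrite lee_fin ler_pdivrMr ?mdist_gt0// mul1r.
Qed.

Definition partition_variation {X} b (gamma : R -> X) (s : seq R) : R :=
  \sum_(0 <= i < (size s).-1)
    mdist (gamma (nth b s i)) (gamma (nth b s i.+1)).

Lemma curve_variationE {X} a b (gamma : R -> X) :
  curve_variation a b gamma =
  ereal_sup [set (partition_variation b gamma (a :: s))%:E
            | s in itv_partition a b]%classic.
Proof.
by congr ereal_sup; apply: eq_imagel.
Qed.

(** Averaging: summed over a partition, the last hypothesis says that the mean over [w] of the
    variation sums of [F w \o gamma] is at least [c] times the sum for [gamma], so some [w] reaches
    this value. The point [w0] keeps the average from being empty. *)
Lemma LCJ_ge {X} (Omega : finType) (w0 : Omega) (F : Omega -> X -> R) (c : R)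
    a b :
  0 < c -> (forall w x y, `|F w x - F w y| <= mdist x y) ->
  (forall x y,
    c * mdist x y * #|Omega|%:R <= \sum_w `|F w x - F w y|) ->
  (c%:E <= LCJ a b X)%E.
Proof.
move=> c0 F1 Fc; apply: le_ereal_inf_tmp => _ [gamma /= /andP[V0 Voo] <-].
have Vfin : curve_variation a b gamma \is a fin_num.
  by rewrite ge0_fin_numE// ltW.
rewrite -(fineK Vfin) in V0 Voo *; set V := fine _ in V0 Voo *.
rewrite lte_fin in V0; rewrite inver gt_eqF// lee_pdivlMr//.
have LE : curve_variation a b gamma = V%:E by rewrite fineK.
rewrite muleC -lee_pdivlMr// -LE curve_variationE.
apply: ge_ereal_sup => _ [s sP <-]; rewrite lee_pdivlMr//.
set S := partition_variation _ _ _.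
pose VF w := partition_variation (X := R^o) b (F w \o gamma) (a :: s).
have [[w Sw]|nw] := pselect (exists w, S * c <= VF w).
  apply: (@le_trans _ _ (curve_variation (X := R^o) a b (F w \o gamma))).
    rewrite curve_variationE -EFinM.
    apply: le_trans (ereal_sup_ubound _); last by exists s.
    by rewrite lee_fin.
  by apply: ereal_sup_ubound; exists (F w) => //; apply/lipschitz1P/F1.
exfalso; have VF_lt w : VF w < S * c.
  by rewrite ltNge; apply/negP => ?; apply: nw; exists w.
have : S * c * #|Omega|%:R <= \sum_w VF w.
  rewrite /VF /partition_variation exchange_big/= /S /partition_variation.
  rewrite !mulr_suml; apply: ler_sum => i _; rewrite [_ * c]mulrC.
  apply: le_trans (Fc _ _) _.
  by apply: ler_sum => w _; rewrite mdist_regular.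
rewrite leNgt => /negP; apply.
rewrite mulr_natr -[ltRHS]sumr_const; apply: ltr_sum => //.
by apply/hasP; exists w0; rewrite ?mem_index_enum.
Qed.

Definition walk_length {X} (x : X) (s : seq X) : R :=
  \sum_(u <- pairmap mdist x s) u.

Lemma walk_length_cons {X} (x y : X) s :
  walk_length x (y :: s) = mdist x y + walk_length y s.
Proof. by rewrite /walk_length/= big_cons. Qed.

(** For [a < b] the curve runs through [x :: s] in order, staying at each point but the last for an
    equal share of the interval; the last one is reached exactly at [b]. *)
Definition step_curve {X} a b (x : X) (s : seq X) (t : R) : X :=
  nth x (x :: s) (Num.truncn ((t - a) / (b - a) * (size s)%:R)).

Lemma mdist_walk {X} (x : X) s i j : (i <= j <= size s)%N ->
  mdist (nth x (x :: s) i) (nth x (x :: s) j) <=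
  \sum_(i <= k < j) nth 0 (pairmap mdist x s) k.
Proof.
case/andP; elim: j => [|j IHj] ij js.
  by move: ij; rewrite leqn0 => /eqP->; rewrite mdistxx big_geq.
move: ij; rewrite leq_eqVlt => /predU1P[->|ij]; first by rewrite mdistxx big_geq.
rewrite big_nat_recr//=; apply: le_trans (metric_triangle _ (nth x (x :: s) j) _) _.
by rewrite lerD ?IHj// 1?ltnW// (nth_pairmap x).
Qed.

(** The index [idx] is monotone in time, so each term of the partition sum is at most the length of
    a block of consecutive steps, and these blocks do not overlap. *)
Lemma partition_variation_step_curve {X} a b (x : X) s t :
  a < b -> itv_partition a b t ->
  partition_variation b (step_curve a b x s) (a :: t) <= walk_length x s.
Proof.
move=> ab tP; have [at_ /eqP lt] := tP.
pose idx u := Num.truncn ((u - a) / (b - a) * (size s)%:R).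
have ba0 : 0 < b - a by rewrite subr_gt0.
have idx_homo u v : u <= v -> (idx u <= idx v)%N.
  move=> uv; apply: le_truncn; rewrite ler_wpM2r// ler_pM2r ?invr_gt0//.
  by rewrite lerD2r.
have idxb : idx b = size s by rewrite /idx divff ?gt_eqF// mul1r natrK.
have nth_le i : (i < size t)%N -> nth b (a :: t) i <= nth b (a :: t) i.+1.
  by move=> it; apply/ltW; move: at_ => /(pathP b); apply.
pose P j := \sum_(0 <= k < j) nth 0 (pairmap mdist x s) k.
pose G i := P (idx (nth b (a :: t) i)).
apply: (@le_trans _ _ (\sum_(0 <= i < size t) (G i.+1 - G i))).
  rewrite /partition_variation/=; apply: ler_sum_nat => i /= it.
  have ii : (idx (nth b (a :: t) i) <= idx (nth b (a :: t) i.+1))%N.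
    exact/idx_homo/nth_le.
  rewrite /G {1}/P (big_cat_nat (leq0n _) ii)/= addrAC subrr add0r.
  apply: mdist_walk; rewrite ii/= -[leqRHS]idxb idx_homo//.
  exact: (@itv_partition_nth_le _ R a b t i.+1).
rewrite telescope_sumr// {1}/G (itv_partition_nth_size _ tP) idxb.
rewrite lerBlDr /walk_length (big_nth 0) size_pairmap lerDl.
rewrite /G /P; have := @mdist_walk _ x s 0 (idx a).
rewrite leq0n/= -[leqRHS]idxb idx_homo ?(itv_partition_le tP)// => /(_ isT).
exact/le_trans/mdist_ge0.
Qed.

Lemma curve_variation_step_curve {X} a b (x : X) s : a < b -> (0 < size s)%N ->
  curve_variation a b (step_curve a b x s) = (walk_length x s)%:E.
Proof.
move=> ab s0; apply/eqP; rewrite eq_le; apply/andP; split.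
  rewrite curve_variationE; apply: ge_ereal_sup => _ [t tP <-].
  by rewrite lee_fin partition_variation_step_curve.
have m0 : 0 < (size s)%:R :> R by rewrite ltr0n.
have ba0 : 0 < b - a by rewrite subr_gt0.
(* The uniform partition attains the supremum: at time [p i] the curve is at the [i]-th point. *)
pose p i : R := a + (b - a) * i%:R / (size s)%:R.
pose t := mkseq (fun i => p i.+1) (size s).
have nth_t i : (i <= size s)%N -> nth b (a :: t) i = p i.
  by case: i => [|i] si; rewrite /= ?nth_mkseq// /p mulr0 mul0r addr0.
have pm : p (size s) = b by rewrite /p mulfK ?gt_eqF// addrC subrK.
have tP : itv_partition a b t.
  split; last by rewrite (last_nth b) size_mkseq nth_t// pm.
  apply/(pathP b) => i; rewrite size_mkseq => si.
  rewrite nth_t 1?ltnW// (nth_t i.+1 si : nth b t i = _) /p.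
  by rewrite ltrD2l ltr_pM2r ?invr_gt0// ltr_pM2l// ltr_nat.
rewrite curve_variationE; apply: le_trans (ereal_sup_ubound _); last by exists t.
rewrite lee_fin /walk_length (big_nth 0) size_pairmap.
rewrite /partition_variation/= size_mkseq; apply: ler_sum_nat => i /= si.
have step_p j : (j <= size s)%N -> step_curve a b x s (p j) = nth x (x :: s) j.
  move=> js; rewrite /step_curve.
  have -> : (p j - a) / (b - a) * (size s)%:R = j%:R.
    by rewrite /p; field; rewrite !gt_eqF.
  by rewrite natrK.
rewrite nth_t 1?ltnW// (nth_t i.+1 si : nth b t i = _) !step_p// 1?ltnW//.
by rewrite (nth_pairmap x).
Qed.

Lemma comp_step_curve {X} a b (f : X -> R) x s :
  f \o step_curve a b x s = step_curve (X := R^o) a b (f x) (map f s).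
Proof.
apply/funext => t; rewrite /step_curve /= size_map -map_cons.
set i := Num.truncn _; have [si|si] := ltnP i (size (x :: s)).
  by rewrite (nth_map x).
by rewrite !nth_default// size_map.
Qed.

Lemma LCJ_le_walk {X} a b (x : X) s (B : R) : a < b -> 0 < walk_length x s ->
  (forall f : X -> R, (forall u v, `|f u - f v| <= mdist u v) ->
    walk_length (X := R^o) (f x) (map f s) <= B) ->
  (LCJ a b X <= (B / walk_length x s)%:E)%E.
Proof.
move=> ab L0 fB.
have s0 : (0 < size s)%N.
  by case: s L0 {fB} => //; rewrite /walk_length big_nil ltxx.
apply: ge_ereal_inf; exists
  (lipschitz_variation a b (step_curve a b x s) / (walk_length x s)%:E)%E.
  exists (step_curve a b x s) => /=; rewrite curve_variation_step_curve//.
  by rewrite lte_fin L0 ltry.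
rewrite inver gt_eqF// EFinM; apply: lee_wpmul2r.
  by rewrite lee_fin invr_ge0 ltW.
apply: ge_ereal_sup => _ [f /lipschitz1P f1 <-].
by rewrite comp_step_curve curve_variation_step_curve ?size_map// lee_fin fB.
Qed.

Fixpoint bounces {T : Type} (M : nat) (u v : T) (s : seq T) : seq T :=
  if M is M'.+1 then u :: v :: bounces M' u v s else s.

(** With [M.+1] repetitions each pair is crossed [M.*2.+1] times, hence at least once, and is left
    at its second point. *)
Definition bounce_walk {T : Type} (M : nat) (ps : seq (T * T)) : seq T :=
  foldr (fun q => bounces M.+1 q.1 q.2) [::] ps.

Lemma map_bounce_walk {T U : Type} (f : T -> U) M ps :
  map f (bounce_walk M ps) = bounce_walk M [seq (f q.1, f q.2) | q <- ps].
Proof.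
have map_bounces u v s m :
    map f (bounces m u v s) = bounces m (f u) (f v) (map f s).
  by elim: m => //= m ->.
by rewrite /bounce_walk; elim: ps => //= q ps <-; rewrite map_bounces.
Qed.

Fixpoint jumps {X} (x : X) (ps : seq (X * X)) : R :=
  if ps is q :: ps' then mdist x q.1 + jumps q.2 ps' else 0.

Lemma walk_length_bounces {X} M (x u v : X) s :
  walk_length x (bounces M.+1 u v s) =
  mdist x u + (M.*2.+1)%:R * mdist u v + walk_length v s.
Proof.
elim: M x => [|M IHM] x.
  by rewrite /= !walk_length_cons mul1r addrA.
have -> : bounces M.+2 u v s = u :: v :: bounces M.+1 u v s by [].
rewrite 2!walk_length_cons IHM.
by rewrite [mdist v u]metric_sym doubleS -!natr1; ring.
Qed.

Lemma walk_length_bounce_walk {X} M (x : X) ps :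
  walk_length x (bounce_walk M ps) =
  (M.*2.+1)%:R * (\sum_(q <- ps) mdist q.1 q.2) + jumps x ps.
Proof.
elim: ps x => [|q ps IHps] x /=.
  by rewrite /walk_length !big_nil mulr0 addr0.
by rewrite walk_length_bounces IHps big_cons; ring.
Qed.

Lemma LCJ_le {X} a b (ps : seq (X * X)) (r : R) : a < b -> 0 <= r ->
  0 < \sum_(q <- ps) mdist q.1 q.2 ->
  (forall f : X -> R, (forall u v, `|f u - f v| <= mdist u v) ->
    \sum_(q <- ps) `|f q.1 - f q.2| <= r * \sum_(q <- ps) mdist q.1 q.2) ->
  (LCJ a b X <= r%:E)%E.
Proof.
move=> ab r0 D0 fps.
have [x0 _] : exists x : X, True.
  by case: ps D0 {fps} => [|q ps]; rewrite ?big_nil ?ltxx//; exists q.1.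
set D := \sum_(q <- ps) _ in D0 fps.
pose J := jumps x0 ps.
have jumps_ge0 x ps' : 0 <= jumps (X := X) x ps'.
  by elim: ps' x => //= q ps' IH x; rewrite addr_ge0 ?mdist_ge0.
apply/lee_addgt0Pr => e e0; rewrite -EFinD.
(* This many repetitions make the total length [J] of the transitions between pairs at most [e]
   times the total length of the crossings. *)
pose M := Num.truncn (J / (e * D)).
have eD0 : 0 < e * D by rewrite mulr_gt0.
have JM : J <= e * D * M.*2.+1%:R.
  rewrite mulrC -ler_pdivrMr//; apply/ltW/(lt_le_trans (truncnS_gt _)).
  by rewrite ler_nat ltnS -addnn leq_addl.
pose s := bounce_walk M ps; have Ls := walk_length_bounce_walk M x0 ps.
have MD0 : 0 < M.*2.+1%:R * D by rewrite mulr_gt0.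
have L0 : 0 < walk_length x0 s by rewrite Ls ltr_pwDl.
apply: le_trans (@LCJ_le_walk _ a b x0 s (M.*2.+1%:R * (r * D) + J) ab L0 _) _.
  move=> f f1.
  rewrite map_bounce_walk (@walk_length_bounce_walk R^o) big_map lerD//.
    rewrite ler_pM2l//; under eq_bigr do rewrite mdist_regular; exact: fps.
  by rewrite /J; move: x0 {J M JM s Ls MD0 L0}; elim: (ps) => //= q ps' IH x0;
    rewrite lerD// mdist_regular.
rewrite lee_fin ler_pdivrMr// Ls -/D -/J.
by have := jumps_ge0 x0 ps; rewrite -/J; nra.
Qed.

End Variation.

(** * Tree distances read off from common prefixes *)

Section TreeDistance.
Context {N : nat}.
Implicit Types x y v : N.-bseq bool.

(** The source of lower bounds for distances: a test function that is controlled on edges only. *)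
Lemma tree_adj_lipschitz (g : N.-bseq bool -> int) :
  (forall x y, tree_child x y -> `|g y - g x| <= 1) ->
  forall x y, `|g x - g y| <= (tree_dist x y)%:Z.
Proof.
move=> gadj x y; have /tree_walkP[p [xp <- <-]] := tree_dist_walk x y.
elim: p x xp => [|v p IHp] x /=; first by rewrite subrr normr0.
case/andP => xv /IHp gv; rewrite -(subrKA (g v)); apply: le_trans (ler_normD _ _) _.
have : `|g x - g v| <= 1 by case/orP: xv => /gadj//; rewrite distrC.
by lia.
Qed.

Lemma tree_dist_take q x : (tree_dist x (take_bseq q x) <= size x - q)%N.
Proof.
have [xq|qx] := leqP (size x) q.
  suff -> : take_bseq q x = x by rewrite tree_distxx.
  by apply/val_inj; rewrite /= take_oversize.
apply: tree_dist_min; rewrite -{1}(subKn (ltnW qx)); move: (leq_subr q (size x)).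
elim: (size x - q)%N => [|j IHj] jx.
  rewrite tree_walk0; apply/eqP/val_inj.
  by rewrite /= subn0 take_size.
rewrite -addn1; apply: tree_walk_trans (IHj (ltnW jx)) _.
apply/tree_walkP; exists [:: take_bseq (size x - j.+1) x]; split=> //=.
rewrite andbT; apply/orP; right; apply/existsP.
exists (nth false x (size x - j.+1)); rewrite /= -take_nth; last by lia.
  by rewrite subnSK.
by rewrite addn1.
Qed.

Lemma tree_dist_le q x y : take q x = take q y ->
  (tree_dist x y <= (size x - q) + (size y - q))%N.
Proof.
move=> xy; apply: leq_trans (tree_dist_triangle (take_bseq q x) _ _) _.
rewrite leq_add ?tree_dist_take// tree_dist_sym.
suff -> : take_bseq q x = take_bseq q y by rewrite tree_dist_take.
exact: val_inj.
Qed.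

Lemma tree_dist_ge q x y : (q < size x)%N -> (q <= size y)%N ->
  take q.+1 x != take q.+1 y ->
  ((size x - q) + (size y - q) <= tree_dist x y)%N.
Proof.
move=> qx qy xy; pose u := take q.+1 x.
have su : size u = q.+1 by rewrite size_take_min; lia.
(* Depth relative to [q], with its sign reversed outside the subtree below [u]. The only edge
   entering that subtree joins the parent of [u] to [u], where [g] takes the values 0 and 1. *)
pose g v : int := if prefix u v then (size v)%:Z - q%:Z else q%:Z - (size v)%:Z.
have gx : g x = (size x)%:Z - q%:Z by rewrite /g prefix_take.
have gy : g y = q%:Z - (size y)%:Z.
  by rewrite /g prefixE su eq_sym (negPf xy).
rewrite -lez_nat; apply: le_trans (@tree_adj_lipschitz g _ x y).
  by rewrite gx gy; lia.
move=> v w /existsP[b /eqP vw]; rewrite /g vw !prefixE su size_rcons.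
have [qv|vq] := ltnP q (size v).
  by rewrite -cats1 takel_cat//; case: ifP; lia.
rewrite [take _ v]take_oversize 1?ltnW// take_oversize ?size_rcons//.
have -> : (v == u :> seq bool) = false.
  by apply/eqP => vu; move: vq; rewrite vu su ltnn.
case: eqP => [uv|_]; last by lia.
by move: su vq; rewrite -uv size_rcons => -[->]; lia.
Qed.

End TreeDistance.

Lemma first_difference (T : eqType) (s t : seq T) : size s = size t -> s != t ->
  exists q, [/\ (q < size s)%N, take q s = take q t &
    take q.+1 s != take q.+1 t].
Proof.
move=> st neq; have ex : exists j, take j s != take j t.
  by exists (size s); rewrite {2}st !take_size.
case: (ex_minnP ex) => -[|q]; first by rewrite !take0 eqxx.
move=> qdiff qmin; exists q; split=> //.
  by apply: qmin; rewrite {2}st !take_size.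
by apply/eqP/negPn/negP => /qmin; rewrite ltnn.
Qed.

Lemma take_neqW (T : eqType) (s t : seq T) m n :
  (m <= n)%N -> take m s != take m t -> take n s != take n t.
Proof.
move=> mn; apply: contraNneq => st.
by rewrite -(take_takel s mn) st take_takel.
Qed.

(** * Random Lipschitz functions on the leaves *)

Section Leaves.
Context {R : realType} {N : nat}.
Implicit Types (x y : N.-bseq bool) (w : {ffun N.-bseq bool -> bool}).

(* For a leaf x, the ancestor at height 2 ^ j - 1, or the root if there is
   none. *)
Definition scale_vertex j x : N.-bseq bool := take_bseq (N - (2 ^ j).-1)%N x.

(** The cutoff is harmless: every [j] with [2 ^ j <= N] occurs, and for larger [j] the bit read is
    that of the root, which cancels in differences. *)
Definition scale_sum w x : R :=
  \sum_(j < N.+1) 2 ^+ j * (w (scale_vertex j x))%:R.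

Lemma sum_pow2_le (h n : nat) : (\sum_(j < n | 2 ^ j <= h) 2 ^ j <= h.*2)%N.
Proof.
rewrite -(big_mkord (fun j => 2 ^ j <= h)%N (fun j => 2 ^ j)%N) big_mkcond/=.
set S := fun m => (\sum_(0 <= j < m) (if 2 ^ j <= h then 2 ^ j else 0))%N.
(* The second bound carries the induction: if [2 ^ n <= h], then adding [2 ^ n] to [S n < 2 ^ n]
   stays below [h.*2]. *)
suff : (S n <= h.*2 /\ S n < 2 ^ n)%N by case.
elim: n => [|n [IH1 IH2]]; first by rewrite /S big_nil.
have -> : S n.+1 = (S n + if 2 ^ n <= h then 2 ^ n else 0)%N.
  by rewrite /S big_nat_recr.
by rewrite expnS; case: ifP => nh; lia.
Qed.

Lemma scale_vertex_eq q x y j : (q <= N)%N -> take q x = take q y ->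
  (N - q < 2 ^ j)%N -> scale_vertex j x = scale_vertex j y.
Proof.
move=> qN xy qj; apply/val_inj => /=.
have jq : (N - (2 ^ j).-1 <= q)%N by lia.
by rewrite -(take_takel x jq) xy take_takel.
Qed.

(** Only scales with [2 ^ j <= N - q] can tell [x] from [y], and their weights form a geometric sum.
    The bound is the distance of two leaves that split at depth [q]. *)
Lemma scale_sum_lipschitz w q x y : (q <= N)%N -> take q x = take q y ->
  `|scale_sum w x - scale_sum w y| <= (N - q).*2%:R.
Proof.
move=> qN xy; rewrite /scale_sum -sumrB; apply: le_trans (ler_norm_sum _ _ _) _.
apply: (@le_trans _ _ (\sum_(j < N.+1 | 2 ^ j <= N - q) 2 ^ j)%N%:R); last first.
  by rewrite ler_nat sum_pow2_le.
rewrite natr_sum [leRHS]big_mkcond/=; apply: ler_sum => j _.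
case: leqP => [_|/(scale_vertex_eq _ _ _ _ qN xy) ->]; last by rewrite subrr normr0.
rewrite -mulrBr normrM ger0_norm ?exprn_ge0// natrX ler_piMr ?exprn_ge0//.
by case: (w _); case: (w _); rewrite ?subrr ?subr0 ?sub0r ?normrN ?normr0 ?normr1.
Qed.

(** Conditioning on all bits but the one at [u] becomes pairing [w] with [toggle u w]. *)
Definition toggle u w : {ffun N.-bseq bool -> bool} :=
  [ffun v => w v (+) (v == u)].

Lemma toggleK u : involutive (toggle u).
Proof. by move=> w; apply/ffunP => v; rewrite !ffunE addbK. Qed.

(** Vertices of different scales lie at different depths, so only the [k]-th term for [x] changes.
    The bound [2 ^ k <= N] keeps scale [k] away from the root, where the larger scales collapse. *)
Lemma scale_sum_toggle w x y k : size x = N -> size y = N -> (2 ^ k <= N)%N ->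
  scale_vertex k x != scale_vertex k y ->
  let w' := toggle (scale_vertex k x) w in
  `|(scale_sum w' x - scale_sum w' y) - (scale_sum w x - scale_sum w y)| =
  2 ^+ k.
Proof.
move=> xN yN kN vxy /=; set u := scale_vertex k x; set w' := toggle u w.
have size_scale (z : N.-bseq bool) j : size z = N ->
    size (scale_vertex j z) = (N - (2 ^ j).-1)%N.
  by move=> zN; rewrite /= size_take_min zN; lia.
have neq (z : N.-bseq bool) j : size z = N -> j != k ->
    (scale_vertex j z == u) = false.
  move=> zN jk; apply/eqP => /(congr1 (fun s : N.-bseq bool => size s)).
  rewrite !size_scale//; have : (2 ^ j != 2 ^ k)%N by rewrite eqn_exp2l.
  by have := expn_gt0 2 j; have := expn_gt0 2 k; lia.
have w'E (z : N.-bseq bool) j : size z = N -> j != k ->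
    w' (scale_vertex j z) = w (scale_vertex j z).
  by move=> zN jk; rewrite ffunE neq// addbF.
have kN1 : (k < N.+1)%N by rewrite ltnS (leq_trans _ kN)// ltnW// ltn_expl.
rewrite /scale_sum -!sumrB (bigD1 (Ordinal kN1))//= big1 => [|j jk]; last first.
  by rewrite !w'E ?subrr.
rewrite addr0 -!mulrBr normrM ger0_norm ?exprn_ge0// !ffunE eqxx.
rewrite [_ == u]eq_sym (negPf vxy) addbF addbT opprB addrA subrK.
by case: (w u); rewrite ?sub0r ?subr0 ?normrN normr1 mulr1.
Qed.

(** The differences for [w] and its toggle are [2 ^ k] apart, so their absolute values add up to at
    least [2 ^ k]. The factor 4 is 2 from this pairing times 2 from [N - q < 2 ^ k.+1]. *)
Lemma scale_sum_spread q x y : size x = N -> size y = N -> (q < N)%N ->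
  take q.+1 x != take q.+1 y ->
  (N - q)%:R * #|{: {ffun N.-bseq bool -> bool}}|%:R <=
  4 * \sum_w `|scale_sum w x - scale_sum w y|.
Proof.
move=> xN yN qN xy; pose k := trunc_log 2 (N - q).
have h0 : (0 < N - q)%N by rewrite subn_gt0.
have /andP[kh hk] : (2 ^ k <= N - q < 2 ^ k.+1)%N by exact: trunc_log_bounds.
have kN : (2 ^ k <= N)%N by lia.
have vxy : scale_vertex k x != scale_vertex k y.
  (* Height [2 ^ k - 1] is less than [N - q], so these ancestors lie below the split. *)
  by rewrite -val_eqE/=; apply: (take_neqW _ _ _ _ _ _ xy); move: kN kh; clear; lia.
set S := \sum_w _; set u := scale_vertex k x.
have SE : S = \sum_w `|scale_sum (toggle u w) x - scale_sum (toggle u w) y|.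
  exact/reindex_inj/(inv_inj (toggleK u)).
suff : 2 ^+ k * #|{: {ffun N.-bseq bool -> bool}}|%:R <= S + S.
  have hk' : (N - q)%:R <= 2 * 2 ^+ k :> R by rewrite -exprS -natrX ler_nat ltnW.
  have /(ler_wpM2r (ler0n R #|{: {ffun N.-bseq bool -> bool}}|)) := hk'.
  by set c := #|_|%:R; lra.
rewrite {2}SE -big_split/= mulr_natr -sumr_const; apply: ler_sum => w _.
by rewrite -(@scale_sum_toggle w x y k)// addrC ler_normB.
Qed.

End Leaves.

Lemma LCJ_leaves (R : realType) (N : nat) (a b : R) :
  ((8^-1)%:E <= LCJ a b (tree_leaves R N))%E.
Proof.
pose word (x : tree_leaves R N) : N.-bseq bool := sval x.
have sz x : size (word x) = N.
  by have := svalP x; rewrite tree_dist_root => /eqP.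
have mE x y : mdist x y = (tree_dist (word x) (word y))%:R by [].
apply: (@LCJ_ge R _ {ffun N.-bseq bool -> bool} [ffun=> true]
   (fun w x => scale_sum w (word x))) => //.
  move=> w x y; have [->|xy] := eqVneq x y; first by rewrite subrr normr0 mdistxx.
  have [|q [qN tq tq1]] := first_difference _ (word x) (word y)
    (etrans (sz x) (esym (sz y))).
    by apply: contra_neq xy => xy; apply/val_inj/val_inj.
  rewrite sz in qN; apply: le_trans (scale_sum_lipschitz w _ _ _ (ltnW qN) tq) _.
  rewrite mE ler_nat; apply: leq_trans (tree_dist_ge _ _ _ _ _ tq1); rewrite ?sz ?addnn//.
  exact: ltnW.
move=> x y; have [->|xy] := eqVneq x y.
  by rewrite mdistxx mulr0 mul0r sumr_ge0.
have [|q [qN tq tq1]] := first_difference _ (word x) (word y)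
    (etrans (sz x) (esym (sz y))).
  by apply: contra_neq xy => xy; apply/val_inj/val_inj.
rewrite sz in qN; have := @scale_sum_spread R N q _ _ (sz x) (sz y) qN tq1.
(* Together with the factor 4 of the spread this gives the constant 8. *)
have : mdist x y <= 2 * (N - q)%:R.
  rewrite mE -natrM ler_nat mul2n -addnn; apply: leq_trans (tree_dist_le _ _ _ tq) _.
  by rewrite !sz.
move=> /(ler_wpM2r (ler0n R #|{: {ffun N.-bseq bool -> bool}}|)).
by set c := #|_|%:R; set S := \sum_w _; lra.
Qed.

(** * Markov convexity and the forks of the tree *)

Section Fork.
Context {R : realType} {N : nat}.
Implicit Types (p : N.-tuple bool) (f : dyadic_tree R N -> R).

Definition ancestor n p : dyadic_tree R N := take_bseq n (bseq_of_tuple p).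

Definition flip m p : N.-tuple bool :=
  [tuple tnth p j (+) (j == m :> nat) | j < N].

Lemma flipK m : involutive (flip m).
Proof. by move=> p; apply/eq_from_tnth => j; rewrite !tnth_mktuple addbK. Qed.

Lemma nth_flip m p i : (i < N)%N ->
  nth false (flip m p) i = nth false p i (+) (i == m).
Proof.
move=> iN; rewrite -[i]/(nat_of_ord (Ordinal iN)).
by rewrite -!tnth_nth tnth_mktuple.
Qed.

Lemma take_flip m n p : (n <= m)%N -> take n (flip m p) = take n p.
Proof.
move=> nm; apply: (@eq_from_nth _ false); first by rewrite !size_take !size_tuple.
move=> i; rewrite size_take_min size_tuple leq_min => /andP[in_ iN].
rewrite !nth_take// nth_flip// (_ : (i == m) = false) ?addbF//.
by apply/eqP; lia.
Qed.

Lemma take_flip_neq m p : (m < N)%N -> take m.+1 p != take m.+1 (flip m p).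
Proof.
move=> mN; apply/eqP => /(congr1 (nth false ^~ m)).
by rewrite !nth_take// nth_flip// eqxx addbT; case: nth.
Qed.

Lemma mdist_tree (x y : dyadic_tree R N) : mdist x y = (tree_dist x y)%:R.
Proof. by []. Qed.

Lemma mdist_flip m h p : (0 < h)%N -> (m + h <= N)%N ->
  h.*2%:R <= mdist (ancestor (m + h) p) (ancestor (m + h) (flip m p)).
Proof.
move=> h0 mhN; rewrite mdist_tree ler_nat.
have sz p' : size (ancestor (m + h) p') = (m + h)%N.
  by rewrite /= size_take_min size_tuple; lia.
have := @tree_dist_ge N m (ancestor (m + h) p) (ancestor (m + h) (flip m p)).
rewrite !sz addKn addnn; apply; [lia|lia|].
by rewrite /= !take_takel ?take_flip_neq//; lia.
Qed.

Lemma mdist_ancestorS n p : mdist (ancestor n.+1 p) (ancestor n p) <= 1.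
Proof.
rewrite mdist_tree (ler_nat _ _ 1).
apply: leq_trans (tree_dist_le n _ _ _) _.
  by rewrite /= take_takel// take_takel.
by rewrite /= !size_take_min; lia.
Qed.

(* Sums over all p of N.-tuple bool stand for expectations along the uniformly
   random descending path p; flip m p branches off p at depth m. *)
Definition drift_energy f h n : R :=
  \sum_p (f (ancestor (n + h) p) - f (ancestor n p)) ^+ 2.

Definition fork_energy f h m : R :=
  \sum_p (f (ancestor (m + h) p) - f (ancestor (m + h) (flip m p))) ^+ 2.

(** The four-point inequality behind Markov convexity: [x] is the handle of a fork, [y] its branch
    point, [z] and [w] its tips. The gap between the two sides is half a perfect square. *)
Lemma fork_inequality (x y z w : R) :
  (z - x) ^+ 2 + (w - x) ^+ 2 + (z - w) ^+ 2 / 2 <=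
  4 * (y - x) ^+ 2 + 2 * (z - y) ^+ 2 + 2 * (w - y) ^+ 2.
Proof.
rewrite -subr_ge0 (_ : _ - _ = (z + w - 4 * y + 2 * x) ^+ 2 / 2); last by field.
by rewrite divr_ge0 ?sqr_ge0.
Qed.

(** The fork inequality at depths [n], [n + h] and [n + h + h], summed over all paths. Flipping bit
    [n + h] permutes the paths and fixes ancestors down to the branch point, so the terms of the
    second tip have the same sums as those of the first. *)
Lemma fork_energy_le f h n :
  2 * drift_energy f h.*2 n + fork_energy f h (n + h) / 2 <=
  4 * drift_energy f h n + 4 * drift_energy f h (n + h).
Proof.
pose X k p := f (ancestor k p); pose T p := flip (n + h) p.
have XT k p : (k <= n + h)%N -> X k (T p) = X k p.
  by move=> knh; congr f; apply/val_inj => /=; exact: take_flip.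
have sumT F : \sum_p F (T p) = \sum_p F p :> R.
  exact/esym/reindex_inj/(inv_inj (flipK (n + h))).
have E1 : drift_energy f h.*2 n =
    \sum_p (X (n + h + h)%N (T p) - X n p) ^+ 2.
  rewrite /drift_energy -addnn addnA.
  rewrite -(sumT (fun p => (X (n + h + h)%N p - X n p) ^+ 2)).
  by apply: eq_bigr => p _; rewrite [X n (T p)]XT// leq_addr.
have E2 : drift_energy f h (n + h) =
    \sum_p (X (n + h + h)%N (T p) - X (n + h)%N p) ^+ 2.
  rewrite /drift_energy.
  rewrite -(sumT (fun p => (X (n + h + h)%N p - X (n + h)%N p) ^+ 2)).
  by apply: eq_bigr => p _; rewrite [X (n + h)%N (T p)]XT.
rewrite [2 * _]mulr_natl mulr2n {2}E1.
rewrite [4 * drift_energy _ _ (n + h)](_ : _ = 2 * drift_energy f h (n + h) +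
  2 * drift_energy f h (n + h)); last by ring.
rewrite {2}E2 /drift_energy /fork_energy mulr_suml !mulr_sumr -!big_split/=.
apply: ler_sum => p _; rewrite -addnn addnA.
by have := fork_inequality (X n p) (X (n + h)%N p) (X (n + h + h)%N p)
  (X (n + h + h)%N (T p)); rewrite /X /T; lra.
Qed.

Lemma sum_even_odd (V : nmodType) (F : nat -> V) n :
  \sum_(0 <= i < n.*2) F i = \sum_(0 <= i < n) (F i.*2 + F i.*2.+1).
Proof.
elim: n => [|n IHn]; first by rewrite !big_nil.
by rewrite doubleS !big_nat_recr//= IHn addrA.
Qed.

(* The fork inequality shows that the first sum, the normalized drift energy at
   scale 2 ^ k, decreases in k by at least an eighth of the fork energy. *)
Lemma fork_energy_telescope f K k :
  (forall u v, `|f u - f v| <= mdist u v) -> (k <= K)%N ->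
  \sum_(0 <= i < 2 ^ (K - k)) drift_energy f (2 ^ k) (i * 2 ^ k) / 2 ^+ k +
  (\sum_(0 <= j < k) \sum_(0 <= i < 2 ^ (K - j.+1))
     fork_energy f (2 ^ j) (i.*2.+1 * 2 ^ j) / 2 ^+ j) / 8
  <= 2 ^+ K * #|{: N.-tuple bool}|%:R.
Proof.
move=> f1; elim: k => [|k IHk] kK.
  rewrite big_nil mul0r addr0 subn0.
  apply: (@le_trans _ _ (\sum_(0 <= i < 2 ^ K) #|{: N.-tuple bool}|%:R)).
    apply: ler_sum_nat => i _; rewrite expr0 divr1 expn0 muln1.
    rewrite /drift_energy -sumr_const; apply: ler_sum => p _.
    rewrite -real_normK ?num_real// expr_le1// addn1.
    exact: le_trans (f1 _ _) (mdist_ancestorS _ _).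
  by rewrite sumr_const_nat subn0 -[leLHS]mulr_natl natrX.
apply: le_trans (IHk (ltnW kK)); rewrite big_nat_recr//= mulrDl.
rewrite [X in _ + X]addrC addrA lerD2r mulr_suml.
have -> : (K - k = (K - k.+1).+1)%N by lia.
(* Each interval of length [2 ^ k.+1] is cut into two halves, with a fork at its midpoint. *)
rewrite (expnS 2 (K - k.+1)) mul2n sum_even_odd -big_split/=; apply: ler_sum_nat => i _.
have := fork_energy_le f (2 ^ k) (i.*2 * 2 ^ k).
rewrite -mulSnr -mul2n -expnS (_ : i.*2 * 2 ^ k = i * 2 ^ k.+1)%N; last first.
  by rewrite expnS -muln2 mulnA.
have c0 : 0 < 2 ^+ k :> R by rewrite exprn_gt0.
rewrite exprS; set c := 2 ^+ k in c0 *; set e1 := drift_energy _ _ _.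
set e2 := drift_energy _ _ _; set e3 := drift_energy _ _ _.
set g := fork_energy _ _ _ => h.
rewrite -subr_ge0.
(* Dividing [fork_energy_le] by [4 * c] normalizes all drift terms and leaves [g / (8 * c)]. *)
rewrite (_ : _ - _ = (4 * e2 + 4 * e3 - (2 * e1 + g / 2)) / (4 * c)).
  by rewrite divr_ge0 ?subr_ge0// mulr_ge0// ltW.
by field; rewrite gt_eqF.
Qed.

(** Branch points sit at odd multiples of [2 ^ k], the midpoints of the dyadic intervals in the
    telescoping sum; the tips sit at the right ends. *)
Definition fork_tips k i p : dyadic_tree R N * dyadic_tree R N :=
  let m := (i.*2.+1 * 2 ^ k)%N in
  (ancestor (m + 2 ^ k) p, ancestor (m + 2 ^ k) (flip m p)).

Definition forks K : seq (dyadic_tree R N * dyadic_tree R N) :=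
  [seq fork_tips k q.1 q.2 | k <- index_iota 0 K,
    q <- [seq (i, p) | i <- index_iota 0 (2 ^ (K - k.+1)),
                       p <- enum {: N.-tuple bool}]].

Lemma sum_forks K (F : dyadic_tree R N * dyadic_tree R N -> R) :
  \sum_(q <- forks K) F q = \sum_(0 <= k < K) \sum_(0 <= i < 2 ^ (K - k.+1))
    \sum_p F (fork_tips k i p).
Proof.
rewrite /forks big_allpairs_dep; apply: eq_bigr => k _.
rewrite big_allpairs; apply: eq_bigr => i _.
by rewrite big_enum.
Qed.

(** All scales weigh the same, since [2 ^ (K - k.+1)] intervals of weight [2 ^ k] always give half
    of [2 ^ K]; hence the factor [K]. *)
Lemma sum_scales K (c : R) :
  \sum_(0 <= k < K) \sum_(0 <= i < 2 ^ (K - k.+1)) \sum_(p : N.-tuple bool)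
    2 ^+ k * c = K%:R * 2 ^+ K * #|{: N.-tuple bool}|%:R * c / 2.
Proof.
under eq_big_nat => k /andP[_ kK].
  rewrite sumr_const_nat subn0 sumr_const -!mulrnA.
  rewrite (_ : 2 ^+ k * c *+ _ = 2 ^+ K * #|{: N.-tuple bool}|%:R * c / 2).
    over.
  rewrite -[LHS]mulr_natl natrM natrX.
  have -> : 2 ^+ K = 2 ^+ k * 2 ^+ (K - k.+1) * 2 :> R.
    by rewrite -exprD -exprSr; congr (_ ^+ _); lia.
  by field.
by rewrite sumr_const_nat subn0 -[LHS]mulr_natl; ring.
Qed.

Lemma mdist_forks K : (2 ^ K <= N)%N ->
  K%:R * 2 ^+ K * #|{: N.-tuple bool}|%:R <=
  \sum_(q <- forks K) mdist q.1 q.2.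
Proof.
move=> KN; rewrite sum_forks.
rewrite [leLHS](_ : _ = K%:R * 2 ^+ K * #|{: N.-tuple bool}|%:R * 2 / 2); last by field.
rewrite -sum_scales; apply: ler_sum_nat => k /andP[_ kK].
apply: ler_sum_nat => i /andP[_ iK]; apply: ler_sum => p _.
rewrite mulrC -natrX -natrM mul2n; apply: mdist_flip; first by rewrite expn_gt0.
apply: leq_trans KN; rewrite -mulSnr -doubleS -doubleMl -mul2n mulnCA -expnS.
rewrite -[X in (_ <= 2 ^ X)%N](subnK kK) expnD.
by rewrite leq_mul2r iK orbT.
Qed.

Lemma variation_forks f K :
  (forall u v, `|f u - f v| <= mdist u v) ->
  \sum_(q <- forks K) `|f q.1 - f q.2| <=
  2 * Num.sqrt K%:R * 2 ^+ K * #|{: N.-tuple bool}|%:R.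
Proof.
move=> f1; case: K => [|K'].
  by rewrite sum_forks big_nil !mulr_ge0 ?sqrtr_ge0.
set K := K'.+1; set s : R := Num.sqrt K%:R.
have s0 : 0 < s by rewrite sqrtr_gt0 ltr0n.
have sK : K%:R = s ^+ 2 by rewrite sqr_sqrtr.
have := fork_energy_telescope f K K f1 (leqnn K).
set G := (\sum_(0 <= j < K) _); set B := \sum_(0 <= i < _) _ => BG.
have B0 : 0 <= B.
  apply: sumr_ge0 => i _; rewrite divr_ge0 ?exprn_ge0//.
  by apply: sumr_ge0 => p _; exact: sqr_ge0.
(* Cauchy-Schwarz in its weighted arithmetic-geometric form. The weight [s], the root of [K],
   balances the two sums: each is at most [s * 2 ^+ K] times the number of paths. *)
have amgm : \sum_(q <- forks K) `|f q.1 - f q.2| <=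
    (s / 8) * G + K%:R * 2 ^+ K * #|{: N.-tuple bool}|%:R * (2 / s) / 2.
  rewrite sum_forks -sum_scales /G mulr_sumr -big_split/=.
  apply: ler_sum => k _; rewrite mulr_sumr -big_split/=.
  apply: ler_sum => i _; rewrite /fork_energy mulr_suml mulr_sumr -big_split/=.
  apply: ler_sum => p _; rewrite -[X in s / 8 * (X / _)]real_normK ?num_real//.
  set t := `|_|; have c0 : 0 < 2 ^+ k :> R by rewrite exprn_gt0.
  set c := 2 ^+ k in c0 *; rewrite -subr_ge0.
  rewrite (_ : _ - _ = (s * t - 4 * c) ^+ 2 / (8 * c * s)).
    by rewrite divr_ge0 ?sqr_ge0// !mulr_ge0// ltW.
  by field; rewrite !gt_eqF.
apply: le_trans amgm _.
rewrite sK; set A := 2 ^+ K in BG *; set c := #|_|%:R in BG *.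
have -> : s ^+ 2 * A * c * (2 / s) / 2 = s * (A * c).
  by field; rewrite gt_eqF.
have -> : 2 * s * A * c = s * (A * c) + s * (A * c) by ring.
rewrite lerD2r -mulrA ler_pM2l// mulrC; lra.
Qed.

End Fork.

(** * The bound for the tree and the explicit constants *)

Lemma LCJ_dyadic_tree (R : realType) (N K : nat) (a b : R) : a < b ->
  (0 < K)%N -> (2 ^ K <= N)%N ->
  (LCJ a b (dyadic_tree R N) <= (2 / Num.sqrt K%:R)%:E)%E.
Proof.
move=> ab K0 KN.
have s0 : 0 < Num.sqrt K%:R :> R by rewrite sqrtr_gt0 ltr0n.
have D := @mdist_forks R N K KN.
have r0 : 0 <= 2 / Num.sqrt K%:R :> R by rewrite divr_ge0// ltW.
have D0 : 0 < \sum_(q <- @forks R N K) mdist q.1 q.2.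
  apply: (lt_le_trans _ D); rewrite !mulr_gt0 ?exprn_gt0 ?ltr0n//.
  by rewrite card_tuple card_bool expn_gt0.
apply: (LCJ_le a b (forks K) _ ab r0 D0) => f f1.
apply: le_trans (variation_forks f K f1) _.
apply: le_trans (ler_wpM2l r0 D).
set s := Num.sqrt _ in s0 *; have -> : K%:R = s ^+ 2 by rewrite sqr_sqrtr.
by rewrite le_eqVlt; apply/orP; left; apply/eqP; field; rewrite gt_eqF.
Qed.

Theorem theorem1p7 (R : realType) :
  exists C c : R, 0 < C /\ 0 < c /\
    forall (a b : R), a < b ->
    forall N : nat, (1 <= N)%N ->
      ((2 <= N)%N ->
        (LCJ a b (dyadic_tree R N) <= (C * ln N%:R `^ (- (1 / 2)))%:E)%E) /\
      (c%:E <= LCJ a b (tree_leaves R N))%E.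
Proof.
exists 4, 8^-1; split=> //; split=> // a b ab N N1; split; last exact: LCJ_leaves.
move=> N2; pose K := trunc_log 2 N.
have K0 : (0 < K)%N by rewrite trunc_log_gt0.
have /andP[KN NK] : (2 ^ K <= N < 2 ^ K.+1)%N by exact: trunc_log_bounds.
apply: le_trans (LCJ_dyadic_tree R N K a b ab K0 KN) _; rewrite lee_fin.
have N0 : 0 < N%:R :> R by rewrite ltr0n.
have ln2 : ln (2 : R) <= 1.
  by rewrite -[leRHS]expRK ler_ln ?posrE ?expR_gt0// (le_trans _ (expR_ge1Dx 1)).
have lnN0 : 0 < ln N%:R :> R by rewrite ln_gt0// ltr1n.
(* Here [ln N <= (K + 1) * ln 2 <= K + 1 <= 4 * K]. The root of this 4, times the 2 in
   [LCJ_dyadic_tree], is the constant [C = 4]. *)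
have lnNK : ln N%:R <= 4 * K%:R :> R.
  apply: (@le_trans _ _ (ln (2 ^+ K.+1))).
    by rewrite ler_ln ?posrE ?exprn_gt0// -natrX ler_nat ltnW.
  rewrite lnXn//; apply: le_trans (ler_wMn2r _ ln2) _.
  by rewrite -natrM ler_nat; lia.
rewrite div1r powRN powR12_sqrt; last exact: ltW.
have s0 : 0 < Num.sqrt K%:R :> R by rewrite sqrtr_gt0 ltr0n.
have l0 : 0 < Num.sqrt (ln N%:R) :> R by rewrite sqrtr_gt0.
rewrite ler_pdivrMr// mulrAC ler_pdivlMr//.
rewrite -(@ler_pM2l _ 2^-1)// !mulrA mulVf// mul1r.
rewrite (_ : 2^-1 * 4 = Num.sqrt 4 :> R); last first.
  by rewrite (_ : 4 = 2 ^+ 2 :> R) ?sqrtr_sqr ?ger0_norm//; field.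
by rewrite -sqrtrM// ler_wsqrtr.
Qed.
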